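(* Let $\mathsf{Matroids}$ be the $\mathsf{R}$-module generated by all functions $[X(M)]$, $M$ a matroid, and let $\mathsf{Graphs}_*$ be the $\mathsf{R}$-module generated by all functions $[Z_G]$, $G$ a finite simple graph. Then $$\mathsf{Matroids}\subset\mathsf{Graphs}_*.$$
   Context: Let $\mathcal{Q}$ be the set of prime powers. For a scheme $X$ of finite type over $\mathbf{Z}$, $[X]$ denotes the function $\mathcal{Q}\to\mathbf{Z}$, $q\mapsto \# X(\mathbf{F}_q)$. Let $\mathsf{S}\subset\mathbf{Z}[q]$ be the saturated multiplicative system (closed under taking divisors) generated by the polynomials $q^n-q$, $n>1$; its elements do not vanish on $\mathcal{Q}$. Put $\mathsf{R}=\mathsf{S}^{-1}\mathbf{Z}[q]$, viewed as a ring of functions $\mathcal{Q}\to\mathbf{Q}$; all modules below are $\mathsf{R}$-modules of functions $\mathcal{Q}\to\mathbf{Q}$. A matroid $M$ is a finite set $E$ with a rank function $\rho:2^E\to\mathbf{N}$ such that $\rho(X)\le \#X$, $\rho(X)\le\rho(Y)$ for $X\subset Y$, and $\rho(X\cup Y)+\rho(X\cap Y)\le\rho(X)+\rho(Y)$. Its rank is $r=\rho(E)$. $X(M)$ is the scheme over $\mathbf{Z}$ of representations of $M$ in rank $r$ space: it is the locally closed subscheme of the affine space of maps $E\to\mathbf{A}^r$ such that for any field $K$, $X(M)(K)$ is the set of maps $f:E\to K^r$ with $\dim\langle f(X)\rangle=\rho(X)$ for all $X\subset E$. Thus $[X(M)](q)$ is the number of such $f$ for $K=\mathbf{F}_q$.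 For a finite simple graph $G$ (no loops, no multiple edges) with vertices $v_1,\dots,v_n$, $Z_G$ is the scheme over $\mathbf{Z}$ of all invertible symmetric $n\times n$ matrices $M$ such that $M_{ij}=0$ whenever there is an edge from $v_i$ to $v_j$. *)

(* Defs.v *)
From HB Require Import structures.
From mathcomp Require Import all_boot all_order all_algebra all_field.

Set Implicit Arguments.
Unset Strict Implicit.
Unset Printing Implicit Defensive.

Import Order.TTheory GRing.Theory Num.Theory.
Local Open Scope ring_scope.

(* A prime power is recorded as its unique pair (p, k); the coercion to nat is
   injective by [pp_val_inj], so functions on this type are exactly functions
   on the set of prime powers. *)
Record prime_power := PrimePower {
  pp_base : nat;
  pp_exp : nat;
  pp_base_prime : prime pp_base;
  pp_exp_gt0 : (0 < pp_exp)%N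
}.

Definition pp_val (q : prime_power) : nat := (pp_base q ^ pp_exp q)%N.
Coercion pp_val : prime_power >-> nat.

Lemma pp_val_gt1 (q : prime_power) : (1 < q)%N.
Proof.
case: q => p k pr_p k_gt0; rewrite /pp_val /=.
by rewrite -(exp1n k) ltn_exp2r // prime_gt1.
Qed.

Lemma pp_val_inj : injective pp_val.
Proof.
move=> [p k pr_p k_gt0] [p' k' pr_p' k'_gt0]; rewrite /pp_val /= => E.
have pp' : p = p'.
  have: p \in primes (p' ^ k') by rewrite -E primesX // primes_prime // inE.
  by rewrite primesX // primes_prime // inE => /eqP.
subst p'.
have kk' : k = k' by apply/eqP; rewrite -(eqn_exp2l _ _ (prime_gt1 pr_p)) E.
by subst k'; congr PrimePower; apply: bool_irrelevance.
Qed.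

Lemma pp_valP (n : nat) :
  (exists p k, [/\ prime p, (0 < k)%N & n = (p ^ k)%N]) <->
  (exists q : prime_power, pp_val q = n).
Proof.
split=> [[p [k [pr_p k_gt0 ->]]]|[[p k pr_p k_gt0] <-]].
  by exists (PrimePower pr_p k_gt0).
by exists p, k.
Qed.

Definition GF (q : prime_power) : finFieldType :=
  s2val (pPrimePowerField (pp_base_prime q) (pp_exp_gt0 q)).

Lemma card_GF (q : prime_power) : #|GF q| = q.
Proof. by rewrite /GF; case: pPrimePowerField. Qed.

(* The function [X] of a scheme X of finite type, given N F = #X(F); such an N
   is invariant under isomorphism, so the choice of GF q is immaterial. *)
Definition point_count (N : finFieldType -> nat) : prime_power -> rat :=
  fun q => (N (GF q))%:R.

(* The saturated multiplicative system of Z[q] generated by the q^n - q; by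
   [in_S_neq0] the divisions in [in_R] are never by zero. *)
Inductive in_S : {poly int} -> Prop :=
| in_S_one : in_S 1
| in_S_gen n : (1 < n)%N -> in_S ('X^n - 'X)
| in_S_mul s t : in_S s -> in_S t -> in_S (s * t)
| in_S_div s t : in_S (s * t) -> in_S s.

Lemma in_S_neq0 (s : {poly int}) (q : prime_power) :
  in_S s -> s.[(q : nat)%:Z] != 0.
Proof.
elim=> {s} [|n n_gt1|s t _ s0 _ t0|s t _].
- by rewrite hornerE.
- rewrite hornerD hornerN hornerXn hornerX subr_eq0.
  rewrite -natz -natrX eqr_nat -[X in _ != X]expn1.
  by rewrite eqn_exp2l ?pp_val_gt1 // neq_ltn n_gt1 orbT.
- by rewrite hornerM mulf_neq0.
- by rewrite hornerM mulf_eq0 negb_or => /andP[].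
Qed.

Definition in_R (c : prime_power -> rat) : Prop :=
  exists (a s : {poly int}), in_S s /\
    forall q : prime_power,
      c q = (a.[(q : nat)%:Z])%:~R / (s.[(q : nat)%:Z])%:~R.

Definition R_span (gens : (prime_power -> rat) -> Prop)
    (f : prime_power -> rat) : Prop :=
  exists (m : nat) (c g : 'I_m -> prime_power -> rat),
    [/\ forall i, in_R (c i), forall i, gens (g i)
      & forall q, f q = \sum_(i < m) c i q * g i q].

Record matroid := Matroid {
  ground : finType;
  mrank : {set ground} -> nat;
  mrank_card : forall X : {set ground}, (mrank X <= #|X|)%N;
  mrank_mono : forall X Y : {set ground},
    X \subset Y -> (mrank X <= mrank Y)%N;
  mrank_submod : forall X Y : {set ground},
    (mrank (X :|: Y) + mrank (X :&: Y) <= mrank X + mrank Y)%N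
}.

Definition matroid_rank (M : matroid) : nat := mrank [set: ground M].

Definition matroid_points (M : matroid) (F : finFieldType) :
    {set {ffun ground M -> 'rV[F]_(matroid_rank M)}} :=
  [set f : {ffun ground M -> 'rV[F]_(matroid_rank M)} |
    [forall X : {set ground M}, \dim <<[seq f x | x in X]>> == mrank X]].

Definition X_fun (M : matroid) : prime_power -> rat :=
  point_count (fun F => #|matroid_points M F|).

Record simple_graph := SimpleGraph {
  nvert : nat;
  edge : rel 'I_nvert;
  edge_sym : symmetric edge;
  edge_irrefl : irreflexive edge
}.

Definition graph_points (G : simple_graph) (F : finFieldType) :
    {set 'M[F]_(nvert G)} :=
  [set A : 'M[F]_(nvert G) |
    [&& A \in unitmx, A^T == A
      & [forall i, forall j, edge i j ==> (A i j == 0)]]].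

Definition Z_fun (G : simple_graph) : prime_power -> rat :=
  point_count (fun F => #|graph_points G F|).

Definition Matroids : (prime_power -> rat) -> Prop :=
  R_span (fun g => exists M : matroid, g = X_fun M).

Definition Graphs_star : (prime_power -> rat) -> Prop :=
  R_span (fun g => exists G : simple_graph, g = Z_fun G).

(* Main.v *)
Require Import Defs.
From mathcomp Require Import all_boot all_order all_algebra all_field.
From mathcomp Require Import ring.

Set Implicit Arguments.
Unset Strict Implicit.
Unset Printing Implicit Defensive.

Import GRing.Theory Num.Theory.
Local Open Scope ring_scope.

(**
  A symmetric [n x n] matrix of rank [r] is [A Q A^T] with [Q] symmetric and
  invertible of size [r] and [A] of size [n x r] and rank [r], uniquely up to
  [GL_r]; a zero entry of the matrix says that two rows of [A] are orthogonal
  for [Q].  Adding an isolated vertex to [G] borders the matrix freely, or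
  adds a free row to [A].  Counting such extensions by rank gives recursions
  with coefficients invertible in [R], through which first the number of
  matrices of [G] of any given rank, and then the number of pairs [(Q, A)] with
  the orthogonality relations of [G] and no condition on the rank of [A], are
  seen to lie in [Graphs_star].

  If [G] is bipartite with parts [E] and a list [L] of subsets of [E], each
  joined to its elements, the count of pairs is the number of invertible [Q]
  (a unit of [R]) times the sum over all [f : E -> F^r] of the product over [X]
  in [L] of [q ^ (r - dim <f(X)>)].  By Lagrange interpolation at the points
  [1, q, .., q^r], the indicator of [dim <f(X)> = rho(X)] is a polynomial in
  [q ^ (r - dim <f(X)>)] with coefficients in [R], so [X(M)] is an [R]-linear
  combination of such sums.
*)

(** * Symmetric matrices bordered by a free row *)

Definition has_zeros (R : nzRingType) n (e : rel 'I_n) (A : 'M[R]_n) :=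
  [forall i, forall j, e i j ==> (A i j == 0)].

(** The new vertex comes first, so a matrix for the larger graph is a [block_mx] whose first row and
    column are free of zero conditions. *)
Definition add_isolated n (e : rel 'I_n) : rel 'I_(1 + n) := fun i j =>
  match split i, split j with inr i', inr j' => e i' j' | _, _ => false end.

Lemma has_zeros_add_isolated (R : nzRingType) n (e : rel 'I_n)
    (A : 'M[R]_(1 + n)) :
  has_zeros (add_isolated e) A = has_zeros e (drsubmx A).
Proof.
apply/'forall_forallP/'forall_forallP => eA i j; apply/implyP.
  move=> eij; have := eA (rshift 1 i) (rshift 1 j).
  by rewrite /add_isolated !(unsplitK (inr _)) eij !mxE.
rewrite /add_isolated; case: (split_ordP i) => // i' ->.
case: (split_ordP j) => // j' -> eij.
by have := eA i' j'; rewrite eij !mxE.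
Qed.

Section FixedField.
Variable F : finFieldType.
Local Notation q := (#|F|%:R : rat).

Lemma sum_if1 (T : finType) (P Q : pred T) :
  \sum_(x | P x) (Q x)%:R = \sum_(x | P x && Q x) 1 :> rat.
Proof.
by rewrite [RHS]big_mkcondr; apply: eq_bigr => x _; case: (Q x).
Qed.

Lemma sum_submx m n (A : 'M[F]_(m, n)) :
  \sum_(v : 'rV[F]_n | (v <= A)%MS) 1 = q ^+ \rank A.
Proof.
rewrite (reindex_onto (mulmxr (row_base A)) (mulmxr (pinvmx (row_base A)))).
  rewrite (eq_bigl xpredT) => [|u]; last first.
    by rewrite /= mulmxKp ?row_base_free // eqxx andbT -(eq_row_base A) submxMl.
  by rewrite sumr_const card_mx mul1n natrX.
by move=> v vA /=; rewrite mulmxKpV ?eq_row_base.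
Qed.

Lemma sum_not_submx m n (A : 'M[F]_(m, n)) :
  \sum_(v : 'rV[F]_n | ~~ (v <= A)%MS) 1 = q ^+ n - q ^+ \rank A.
Proof.
have <- : \sum_(v : 'rV[F]_n) 1 = q ^+ n.
  by rewrite sumr_const card_mx mul1n natrX.
rewrite [X in X - _](bigID (fun v => (v <= A)%MS)) /= sum_submx.
by rewrite addrAC subrr add0r.
Qed.

Lemma rank_col_mx_row m n (v : 'rV[F]_n) (A : 'M[F]_(m, n)) :
  \rank (col_mx v A) = (\rank A + ~~ (v <= A)%MS)%N.
Proof.
rewrite -addsmxE; case vA: (v <= A)%MS => /=.
  by rewrite addn0; apply/eqP; rewrite (addsmx_idPr vA).
apply/eqP; rewrite eqn_leq; apply/andP; split.
  apply: leq_trans (mxrank_adds_leqif _ _) _.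
  by rewrite addnC leq_add2l rank_leq_row.
rewrite addn1 ltn_neqAle mxrankS ?addsmxSr // andbT.
apply: contraFN vA => /eqP rkE.
have /eqmxP/eqmx_sym AE : (A == v + A)%MS.
  by rewrite -(geq_leqif (mxrank_leqif_eq (addsmxSr v A))) rkE.
by rewrite -AE addsmxSl.
Qed.

(** If [v = u *m S], a unipotent congruence clears the border and leaves the diagonal blocks [a - c]
    and [S], where [c = v *m u^T]. Otherwise the new column and the new row each raise the rank by
    one. *)
Lemma rank_symmetric_border n (a : F) (v : 'rV[F]_n) (S : 'M[F]_n) :
  S^T = S ->
  \rank (block_mx a%:M v v^T S) =
    if (v <= S)%MS
    then (\rank S + (a != (v *m (v *m pinvmx S)^T) ord0 ord0))%N
    else (\rank S + 2)%N.
Proof.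
move=> Ssym; case: ifP => vS; last first.
  rewrite [block_mx _ _ _ _]/block_mx rank_col_mx_row.
  have -> : \rank (row_mx v^T S) = (\rank S + 1)%N.
    by rewrite -mxrank_tr tr_row_mx trmxK Ssym rank_col_mx_row vS.
  (* If the top row were a combination of the lower ones, [v] would lie in the row space of [S]. *)
  suff -> : (row_mx a%:M v <= row_mx v^T S)%MS = false by rewrite -addnA.
  apply: contraFF vS => /submxP[w]; rewrite mul_mx_row => /eq_row_mx[_ ->].
  exact: submxMl.
set u := v *m pinvmx S; have uS : u *m S = v by rewrite mulmxKpV.
set c := (v *m u^T) ord0 ord0.
have cE : v *m u^T = c%:M by apply/matrixP => i j; rewrite !ord1 [RHS]mxE eqxx.
have -> : block_mx a%:M v v^T S =
    block_mx 1%:M u 0 1%:M *m block_mx (a - c)%:M 0 0 S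
      *m block_mx 1%:M 0 u^T 1%:M.
  rewrite !mulmx_block !mul1mx !mulmx1 !mul0mx !mulmx0 !addr0 !add0r uS cE.
  rewrite -raddfD subrK; congr block_mx.
  by rewrite -uS trmx_mul Ssym.
have uU : (block_mx (1%:M : 'M_1) u 0 1%:M) \in unitmx.
  by rewrite unitmxE det_ublock !det1 mulr1 unitr1.
have uL : (block_mx (1%:M : 'M_1) 0 u^T 1%:M) \in unitmx.
  by rewrite unitmxE det_lblock !det1 mulr1 unitr1.
rewrite mxrankMfree ?row_free_unit // eqmxMfull ?row_full_unit //.
rewrite rank_diag_block_mx addnC -[a == c]subr_eq0 rank_rV.
by rewrite -scalemx1 scalemx_eq0 oner_eq0 orbF.
Qed.

Definition count_sym n (e : rel 'I_n) (t : nat) : rat :=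
  \sum_(S : 'M[F]_n | [&& \rank S == t, S^T == S & has_zeros e S]) 1.

(** For [v] in the row space of [S], one corner [a] keeps the rank and the [q - 1] others raise it
    by one; for any other [v], all [q] corners raise it by two. *)
Lemma sum_border_rank n (S : 'M[F]_n) (t : nat) : S^T = S ->
  \sum_(w : 'rV[F]_n * F | \rank (block_mx w.2%:M w.1 w.1^T S) == t) 1 =
  q ^+ \rank S * (\rank S == t)%:R
  + q ^+ \rank S * (q - 1) * ((\rank S).+1 == t)%:R
  + (q ^+ n - q ^+ \rank S) * q * ((\rank S).+2 == t)%:R.
Proof.
move=> Ssym; set s := \rank S.
rewrite -(pair_big_dep xpredT (fun v a => \rank (block_mx a%:M v v^T S) == t)
  (fun _ _ => 1)) /=.
rewrite (bigID (fun v : 'rV_n => (v <= S)%MS)) /=; congr (_ + _); last first.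
  rewrite -(sum_not_submx S) -mulrA mulr_suml; apply: eq_bigr => v /negbTE vS.
  under eq_bigl do rewrite rank_symmetric_border // vS addn2.
  by case: eqP => _; rewrite /= mul1r ?mulr1 ?mulr0 ?big_pred0_eq // sumr_const.
rewrite -(sum_submx S) -mulrA -mulrDr mulr_suml; apply: eq_bigr => v vS.
rewrite mul1r; under eq_bigl do rewrite rank_symmetric_border // vS.
set c := (_ *m _) _ _; rewrite (bigID (pred1 c)) /=; congr (_ + _).
  rewrite (eq_bigl (fun a => (a == c) && (s == t))) => [|a]; last first.
    by case: (a =P c) => _; rewrite ?andbF // addn0 andbT.
  by rewrite big_mkcondr big_pred1_eq; case: (s == t).
rewrite (eq_bigl (fun a => (a != c) && (s.+1 == t))) => [|a]; last first.
  by case: (a =P c) => _; rewrite ?andbF // addn1 andbT.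
rewrite big_mkcondr /=; case: (s.+1 == t); last by rewrite big1 // mulr0.
rewrite mulr1 sumr_const cardC1 -subn1 natrB //.
by apply/card_gt0P; exists 0.
Qed.

Lemma count_sym_add_isolated n (e : rel 'I_n) (t : nat) :
  count_sym (add_isolated e) t =
  \sum_(S : 'M[F]_n | (S^T == S) && has_zeros e S)
    (q ^+ \rank S * (\rank S == t)%:R
     + q ^+ \rank S * (q - 1) * ((\rank S).+1 == t)%:R
     + (q ^+ n - q ^+ \rank S) * q * ((\rank S).+2 == t)%:R).
Proof.
pose border (x : 'M[F]_n * ('rV[F]_n * F)) : 'M[F]_(1 + n) :=
  block_mx x.2.2%:M x.2.1 x.2.1^T x.1.
pose unborder (A : 'M[F]_(1 + n)) :=
  (drsubmx A, (ursubmx A, ulsubmx A ord0 ord0)).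
rewrite /count_sym (reindex_onto border unborder) /=; last first.
  move=> A /and3P[_ /eqP Asym _]; rewrite /border /=.
  rewrite trmx_ursub Asym -[RHS]submxK; congr block_mx.
  by apply/matrixP => i j; rewrite !ord1 mxE eqxx.
transitivity (\sum_(S : 'M[F]_n | (S^T == S) && has_zeros e S)
  \sum_(w : 'rV[F]_n * F | \rank (block_mx w.2%:M w.1 w.1^T S) == t) (1 : rat)).
  rewrite pair_big_dep /=; apply: eq_bigl => -[S [v a]].
  rewrite /unborder /border /= block_mxKul block_mxKur block_mxKdr mxE eqxx.
  rewrite eqxx andbT has_zeros_add_isolated block_mxKdr.
  rewrite tr_block_mx trmxK tr_scalar_mx andbC; congr (_ && _ && _).
  by apply/eqP/eqP => [/eq_block_mx[]|->].
by apply: eq_bigr => S /andP[/eqP Ssym _]; rewrite sum_border_rank.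
Qed.

(** * Gram matrices *)

Lemma sum_add_row_rank n r (A : 'M[F]_(n, r)) (t : nat) :
  \sum_(v : 'rV[F]_r | \rank (col_mx v A) == t) 1 =
  q ^+ \rank A * (\rank A == t)%:R
  + (q ^+ r - q ^+ \rank A) * ((\rank A).+1 == t)%:R.
Proof.
rewrite (bigID (fun v : 'rV_r => (v <= A)%MS)) /=; congr (_ + _).
  rewrite -(sum_submx A) mulr_suml [LHS]big_mkcondl [RHS]big_mkcond /=.
  rewrite [LHS]big_mkcond; apply: eq_bigr => v _; rewrite rank_col_mx_row.
  by case: (v <= A)%MS; rewrite ?if_same // addn0 mul1r; case: eqP.
rewrite -(sum_not_submx A) mulr_suml [LHS]big_mkcondl [RHS]big_mkcond /=.
rewrite [LHS]big_mkcond; apply: eq_bigr => v _; rewrite rank_col_mx_row.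
by case: (v <= A)%MS; rewrite ?if_same // addn1 mul1r; case: eqP.
Qed.

(** Rows are chosen one at a time, each outside the span of the independent rows already present. *)
Lemma sum_row_free n r :
  \sum_(A : 'M[F]_(n, r) | \rank A == n) 1 = \prod_(i < n) (q ^+ r - q ^+ i).
Proof.
elim: n => [|n IHn].
  rewrite big_ord0 (eq_bigl xpredT) => [|A]; last by rewrite flatmx0 mxrank0.
  by rewrite sumr_const card_mx mul0n.
rewrite big_ord_recr /= -IHn mulr_suml.
pose add_row (x : 'M[F]_(n, r) * 'rV[F]_r) : 'M_(1 + n, r) := col_mx x.2 x.1.
rewrite (reindex_onto add_row (fun A => (dsubmx A, usubmx A))) /=; last first.
  by move=> A _; rewrite /add_row vsubmxK.
rewrite (eq_bigl (fun x => \rank (col_mx x.2 x.1) == n.+1)) => [|[A v]];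
  last first.
  by rewrite /add_row /= col_mxKu col_mxKd eqxx andbT.
rewrite -(pair_big_dep xpredT (fun (A : 'M[F]_(n, r)) (v : 'rV[F]_r) =>
  \rank (col_mx v A) == n.+1) (fun _ _ => 1)) /= [RHS]big_mkcond.
apply: eq_bigr => A _; rewrite sum_add_row_rank eqSS.
(* One more row cannot lift a rank below [n] to [n.+1], so only the [A] of rank [n] contribute. *)
have := rank_leq_row A; rewrite leq_eqVlt => /predU1P[-> | ltAn].
  by rewrite eqxx ltn_eqF // mulr0 add0r mulr1 mul1r.
by rewrite (ltn_eqF (leqW ltAn)) (ltn_eqF ltAn) !mulr0 addr0.
Qed.

Definition count_gl r : rat := \prod_(i < r) (q ^+ r - q ^+ i).

Lemma count_glE r : \sum_(g : 'M[F]_r | g \in unitmx) 1 = count_gl r.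
Proof.
by rewrite /count_gl -sum_row_free; apply: eq_bigl => g; rewrite -row_free_unit.
Qed.

Definition nondeg_sym r : pred 'M[F]_r := fun Q => (Q \in unitmx) && (Q^T == Q).

(** The rank [j] interpolates between two uses: [j = r] leads back to [count_sym], and the sum over
    all [j] puts no rank condition on [A]. *)
Definition count_gram n (e : rel 'I_n) (r j : nat) : rat :=
  \sum_(Q : 'M[F]_r | nondeg_sym Q)
     \sum_(A : 'M[F]_(n, r) | has_zeros e (A *m Q *m A^T) && (\rank A == j)) 1.

(** The new row of [A] is unconstrained: inside the row space of the old rows it keeps the rank,
    outside it raises the rank by one. *)
Lemma count_gram_add_isolated n (e : rel 'I_n) (r j : nat) :
  count_gram (add_isolated e) r j.+1 =
  q ^+ j.+1 * count_gram e r j.+1 + (q ^+ r - q ^+ j) * count_gram e r j.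
Proof.
rewrite /count_gram !mulr_sumr -big_split /=; apply: eq_bigr => Q _.
pose add_row (x : 'M[F]_(n, r) * 'rV[F]_r) : 'M_(1 + n, r) := col_mx x.2 x.1.
rewrite (reindex_onto add_row (fun A => (dsubmx A, usubmx A))) /=; last first.
  by move=> A _; rewrite /add_row vsubmxK.
rewrite (eq_bigl (fun x => has_zeros e (x.1 *m Q *m x.1^T)
    && (\rank (col_mx x.2 x.1) == j.+1))) => [|[A v]]; last first.
  rewrite /add_row /= col_mxKu col_mxKd eqxx andbT; congr (_ && _).
  rewrite has_zeros_add_isolated mul_col_mx tr_col_mx mul_col_row.
  by rewrite block_mxKdr.
rewrite -(pair_big_dep (fun A : 'M[F]_(n, r) => has_zeros e (A *m Q *m A^T))
  (fun (A : 'M[F]_(n, r)) (v : 'rV[F]_r) => \rank (col_mx v A) == j.+1)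
  (fun _ _ => 1)) /=.
rewrite -!sum_if1 !mulr_sumr -big_split; apply: eq_bigr => A _ /=.
rewrite sum_add_row_rank eqSS.
by congr (_ + _); case: eqP => [->|_]; rewrite ?mulr0.
Qed.

(** The transposes of these [A] are the bases of the row space of [S], on which [GL_r] acts simply
    transitively. *)
Lemma sum_eqmx_row_full n r (S : 'M[F]_n) : \rank S = r ->
  \sum_(A : 'M[F]_(n, r) | (\rank A == r) && (A^T == S)%MS) 1 = count_gl r.
Proof.
move=> <-; rewrite -count_glE; pose B := row_base S.
rewrite (reindex_onto (fun g => (g *m B)^T) (fun A => A^T *m pinvmx B)) /=.
  apply: eq_bigl => g; rewrite trmxK mxrank_tr mxrankMfree ?row_base_free //.
  rewrite mulmxKp ?row_base_free // eqxx andbT.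
  rewrite -row_free_unit; apply: andb_idr => rkg.
  have gfull : row_full g by rewrite row_full_unit -row_free_unit.
  by apply/eqmxP; apply: eqmx_trans (eqmxMfull _ gfull) (eq_row_base S).
move=> A /andP[_ /andP[AS _]].
by rewrite mulmxKpV ?trmxK // eq_row_base.
Qed.

(* A symmetric [S] with the row space of [A^T] is [A Q A^T] for the unique
   [Q = L S L^T], where [L] is a left inverse of [A]. *)
Lemma sum_gram_row_full n (e : rel 'I_n) r (A : 'M[F]_(n, r)) : \rank A = r ->
  \sum_(Q : 'M[F]_r | nondeg_sym Q && has_zeros e (A *m Q *m A^T)) 1 =
  \sum_(S : 'M[F]_n | [&& \rank S == r, S^T == S & has_zeros e S]
                        && (A^T == S)%MS) 1 :> rat.
Proof.
move=> rkA; have Afull : row_full A by rewrite /row_full rkA.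
have /row_fullP[L LA] := Afull.
have ATfree : row_free A^T by rewrite /row_free mxrank_tr rkA.
have rk_gram Q : \rank (A *m Q *m A^T) = \rank Q.
  by rewrite mxrankMfree // -mxrank_tr trmx_mul mxrankMfree // mxrank_tr.
have gramK Q : L *m (A *m Q *m A^T) *m L^T = Q.
  by rewrite !mulmxA LA mul1mx -mulmxA -trmx_mul LA trmx1 mulmx1.
have gramKV S : S^T = S -> (S <= A^T)%MS ->
    A *m (L *m S *m L^T) *m A^T = S.
  move=> Ssym SA; have /submxP[X SE] := SA.
  have SLA : S *m L^T *m A^T = S.
    by rewrite -mulmxA -trmx_mul SE -mulmxA -trmx_mul -(mulmxA A L A) LA mulmx1.
  have ALS : A *m L *m S = S.
    by rewrite -[RHS]Ssym -[in RHS]SLA !trmx_mul !trmxK Ssym mulmxA.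
  by rewrite !mulmxA ALS SLA.
rewrite [RHS](reindex_onto (fun Q => A *m Q *m A^T) (fun S => L *m S *m L^T)).
  apply: eq_bigl => Q; rewrite gramK eqxx andbT rk_gram /nondeg_sym.
  rewrite -row_free_unit /row_free -!andbA; case rkQ: (\rank Q == r) => //=.
  have -> : (A^T == A *m Q *m A^T)%MS.
    apply/eqmxP/eqmx_sym/eqmxMfull.
    by rewrite /row_full -mxrank_tr trmx_mul mxrankMfree ?mxrank_tr.
  rewrite andbT; congr (_ && _); rewrite !trmx_mul trmxK mulmxA.
  apply/eqP/eqP => [-> //|E].
  by rewrite -[LHS]gramK E gramK.
move=> S /andP[/and3P[_ /eqP Ssym _] /andP[_ SA]].
exact: gramKV.
Qed.

(** Double counting of pairs [(A, S)] where [S] has the row space of [A^T]: for fixed [A] the [S]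
    correspond to the [Q], and for fixed [S] there are [count_gl r] choices of [A]. *)
Lemma count_gram_full n (e : rel 'I_n) (r : nat) :
  count_gram e r r = count_gl r * count_sym e r.
Proof.
rewrite /count_gram (exchange_big_dep (fun A => \rank A == r)) /=; last first.
  by move=> Q A _ /andP[].
under eq_bigr => A rkA.
  under eq_bigl do rewrite rkA andbT.
  rewrite sum_gram_row_full ?(eqP rkA) //.
  over.
rewrite (exchange_big_dep (fun S : 'M[F]_n =>
  [&& \rank S == r, S^T == S & has_zeros e S])) /=; last first.
  by move=> A S _ /andP[].
rewrite /count_sym mulr_sumr; apply: eq_bigr => S Sr; rewrite Sr mulr1.
by rewrite sum_eqmx_row_full //; case/andP: Sr => /eqP.
Qed.

End FixedField.

(** * The ring R and its modules of functions *)

Lemma in_S_X : in_S 'X.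
Proof.
apply: (@in_S_div 'X ('X - 1)); rewrite mulrBr mulr1 -expr2.
exact: in_S_gen.
Qed.

Lemma in_S_Xn n : in_S 'X^n.
Proof.
elim: n => [|n IHn]; first exact: in_S_one.
by rewrite exprS; apply: in_S_mul in_S_X IHn.
Qed.

(** By saturation: up to a power of ['X] this is ['X^(n - m) - 1], a divisor of the generator
    ['X^(n - m).+1 - 'X]. *)
Lemma in_S_XnsubXm m n : (m < n)%N -> in_S ('X^n - 'X^m).
Proof.
move=> ltmn; have -> : 'X^n - 'X^m = ('X^(n - m) - 1) * 'X^m :> {poly int}.
  by rewrite mulrBl mul1r -exprD subnK // ltnW.
apply: in_S_mul (in_S_Xn m); apply: (@in_S_div _ 'X).
by rewrite mulrBl mul1r -exprSr; apply: in_S_gen; rewrite ltnS subn_gt0.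
Qed.

Lemma in_R_poly (a : {poly int}) : in_R (fun q => (a.[(q : nat)%:Z])%:~R).
Proof.
by exists a, 1; split=> [|q]; [apply: in_S_one | rewrite hornerC divr1].
Qed.

Lemma in_R_inv (s : {poly int}) :
  in_S s -> in_R (fun q => (s.[(q : nat)%:Z])%:~R^-1).
Proof. by move=> Ss; exists 1, s; split=> // q; rewrite hornerC mul1r. Qed.

Lemma in_R_mul c d : in_R c -> in_R d -> in_R (fun q => c q * d q).
Proof.
move=> [a [s [Ss cE]]] [b [t [St dE]]]; exists (a * b), (s * t).
split=> [|q]; first exact: in_S_mul.
by rewrite cE dE !hornerM !intrM invfM mulrACA.
Qed.

Lemma in_R_ext c d : (forall q, d q = c q) -> in_R c -> in_R d.
Proof.
by move=> E [a [s [Ss cE]]]; exists a, s; split=> // q; rewrite E cE.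
Qed.

Lemma horner_XnsubXm m n (q : prime_power) :
  (('X^n - 'X^m : {poly int}).[(q : nat)%:Z])%:~R
    = q%:R ^+ n - q%:R ^+ m :> rat.
Proof. by rewrite hornerD hornerN !hornerXn rmorphB /= !rmorphXn. Qed.

Lemma XnsubXm_neq0 m n (q : prime_power) : m != n ->
  q%:R ^+ n - q%:R ^+ m != 0 :> rat.
Proof.
move=> ne; rewrite -!natrX subr_eq0 eqr_nat eqn_exp2l ?pp_val_gt1 //.
by rewrite eq_sym.
Qed.

Lemma in_R_Xn n : in_R (fun q => q%:R ^+ n).
Proof.
apply: in_R_ext (in_R_poly 'X^n) => q.
by rewrite hornerXn [RHS]rmorphXn.
Qed.

Lemma in_R_opp c : in_R c -> in_R (fun q => - c q).
Proof.
move=> cR; apply: in_R_ext (in_R_mul (in_R_poly (-1)) cR) => q.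
by rewrite hornerN hornerC mulN1r.
Qed.

Lemma in_R_XnsubXm m n : in_R (fun q => q%:R ^+ n - q%:R ^+ m).
Proof.
by apply: in_R_ext (in_R_poly ('X^n - 'X^m)) => q; rewrite horner_XnsubXm.
Qed.

Lemma in_R_invXn n : in_R (fun q => (q%:R ^+ n)^-1).
Proof.
apply: in_R_ext (in_R_inv (in_S_Xn n)) => q.
by rewrite hornerXn [in RHS]rmorphXn.
Qed.

Lemma in_R_invXnsubXm m n : m != n ->
  in_R (fun q => (q%:R ^+ n - q%:R ^+ m)^-1).
Proof.
rewrite neq_ltn => /orP[ltmn|ltnm].
  apply: in_R_ext (in_R_inv (in_S_XnsubXm ltmn)) => q.
  by rewrite horner_XnsubXm.
apply: in_R_ext (in_R_opp (in_R_inv (in_S_XnsubXm ltnm))) => q.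
by rewrite horner_XnsubXm -invrN opprB.
Qed.

Lemma in_R_prod I (r : seq I) (P : pred I) (c : I -> prime_power -> rat) :
  (forall i, P i -> in_R (c i)) -> in_R (fun q => \prod_(i <- r | P i) c i q).
Proof.
move=> cR; elim: r => [|i r IHr].
  by apply: in_R_ext (in_R_Xn 0) => q; rewrite big_nil.
apply: (@in_R_ext (fun q => (if P i then c i q else 1)
                              * \prod_(i <- r | P i) c i q)) => [q|].
  by rewrite big_cons; case: (P i); rewrite ?mul1r.
apply: in_R_mul IHr; case: (boolP (P i)) => [/cR //|_].
by apply: in_R_ext (in_R_Xn 0).
Qed.

Section Span.
Variable gens : (prime_power -> rat) -> Prop.
Implicit Types f g : prime_power -> rat.

Lemma R_span_ext f g : (forall q, g q = f q) -> R_span gens f -> R_span gens g.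
Proof.
by move=> E [m [c [h [cR hG fE]]]]; exists m, c, h; split=> // q; rewrite E.
Qed.

Lemma R_span_gen f : gens f -> R_span gens f.
Proof.
move=> fG; exists 1, (fun _ _ => 1), (fun _ => f).
split=> // [_|q]; first exact: in_R_ext (in_R_Xn 0).
by rewrite big_ord1 mul1r.
Qed.

Lemma R_span0 : R_span gens (fun _ => 0).
Proof.
exists 0, (fun _ _ => 0), (fun _ _ => 0).
by split=> [[]|[]|q] //; rewrite big_ord0.
Qed.

Lemma R_spanD f g :
  R_span gens f -> R_span gens g -> R_span gens (fun q => f q + g q).
Proof.
move=> [m [c [h [cR hG fE]]]] [m' [c' [h' [cR' hG' gE]]]].
exists (m + m')%N.
exists (fun i => match split i with inl j => c j | inr j => c' j end).
exists (fun i => match split i with inl j => h j | inr j => h' j end).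
split=> [i|i|q]; [by case: (split i) | by case: (split i) |].
rewrite big_split_ord fE gE; congr (_ + _); apply: eq_bigr => i _.
  by rewrite (unsplitK (inl _)).
by rewrite (unsplitK (inr _)).
Qed.

Lemma R_spanZ c f :
  in_R c -> R_span gens f -> R_span gens (fun q => c q * f q).
Proof.
move=> cR [m [d [h [dR hG fE]]]].
exists m, (fun i q => c q * d i q), h; split=> // [i|q].
  exact: in_R_mul.
by rewrite fE mulr_sumr; apply: eq_bigr => i _; rewrite mulrA.
Qed.

Lemma R_spanB f g :
  R_span gens f -> R_span gens g -> R_span gens (fun q => f q - g q).
Proof.
move=> fG gG; apply: R_spanD => //.
apply: R_span_ext (R_spanZ (in_R_opp (in_R_Xn 0)) gG) => q.
by rewrite mulN1r.
Qed.

Lemma R_span_sum I (r : seq I) (f : I -> prime_power -> rat) :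
  (forall i, R_span gens (f i)) -> R_span gens (fun q => \sum_(i <- r) f i q).
Proof.
move=> fG; elim: r => [|i r IHr].
  by apply: R_span_ext R_span0 => q; rewrite big_nil.
by apply: R_span_ext (R_spanD (fG i) IHr) => q; rewrite big_cons.
Qed.

End Span.

Lemma R_span_trans gens gens' f :
  (forall g, gens g -> R_span gens' g) -> R_span gens f -> R_span gens' f.
Proof.
move=> sub [m [c [h [cR hG fE]]]].
apply: R_span_ext fE _; apply: R_span_sum => i.
by apply: R_spanZ => //; apply: sub.
Qed.

(** * Closure properties of Graphs_star *)

Lemma add_isolated_sym n (e : rel 'I_n) :
  symmetric e -> symmetric (add_isolated e).
Proof.
by move=> esym i j; rewrite /add_isolated; case: (split i); case: (split j).
Qed.

Lemma add_isolated_irrefl n (e : rel 'I_n) :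
  irreflexive e -> irreflexive (add_isolated e).
Proof. by move=> eirr i; rewrite /add_isolated; case: (split i). Qed.

Definition graph_add_isolated (G : simple_graph) : simple_graph :=
  SimpleGraph (add_isolated_sym (@edge_sym G))
              (add_isolated_irrefl (@edge_irrefl G)).

Lemma Z_funE G q : Z_fun G q = count_sym (GF q) (@edge G) (nvert G).
Proof.
rewrite /Z_fun /point_count /graph_points -sum1_card natr_sum /count_sym.
by apply: eq_bigl => A; rewrite inE -row_free_unit.
Qed.

Lemma count_sym_big (F : finFieldType) n (e : rel 'I_n) t :
  (n < t)%N -> count_sym F e t = 0.
Proof.
move=> ltnt; rewrite /count_sym big_pred0 // => S.
by rewrite (ltn_eqF (leq_ltn_trans (rank_leq_row S) ltnt)).
Qed.

(** Stated at [t.+2] so that the lowest rank involved is [t]; its coefficient vanishes only for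
    [t = n], so the relation can be solved for [count_sym F e t]. *)
Lemma count_sym_add_isolatedSS (F : finFieldType) n (e : rel 'I_n) t :
  count_sym F (add_isolated e) t.+2 =
  #|F|%:R ^+ t.+2 * count_sym F e t.+2
  + (#|F|%:R ^+ t.+2 - #|F|%:R ^+ t.+1) * count_sym F e t.+1
  + (#|F|%:R ^+ n.+1 - #|F|%:R ^+ t.+1) * count_sym F e t.
Proof.
have count_symE s : count_sym F e s =
    \sum_(S : 'M[F]_n | (S^T == S) && has_zeros e S) (\rank S == s)%:R.
  by rewrite sum_if1; apply: eq_bigl => S; rewrite andbC.
rewrite count_sym_add_isolated !count_symE !mulr_sumr -!big_split /=.
apply: eq_bigr => S _; rewrite !eqSS; congr (_ + _ + _).
- by case: eqP => [->|]; rewrite ?mulr0.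
- by case: eqP => [->|]; rewrite ?mulr0 // !exprS; ring.
by case: eqP => [->|]; rewrite ?mulr0 // !exprS; ring.
Qed.

(** Induction on the corank. Corank 0 is [Z_fun G], and ranks above [nvert G] do not occur.
    Otherwise the border recursion at rank [s.+2] is solved for rank [s]; its other terms have
    smaller corank, including the one for the graph with an added vertex. *)
Lemma Graphs_star_count_sym (G : simple_graph) s :
  Graphs_star (fun q => count_sym (GF q) (@edge G) s).
Proof.
have [d] : exists d, (nvert G <= s + d)%N by exists (nvert G); rewrite leq_addl.
elim: d => [|d IHd] in G s *.
  rewrite addn0 leq_eqVlt => /predU1P[<-|lt_s].
    by apply: R_span_ext (@R_span_gen _ (Z_fun G) _) => [q|];
       [rewrite Z_funE | exists G].
  by apply: R_span_ext (@R_span0 _) => q; rewrite count_sym_big.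
rewrite leq_eqVlt => /predU1P[nE|]; last by rewrite addnS ltnS; apply: IHd.
pose G' := graph_add_isolated G.
have G'star : Graphs_star (fun q => count_sym (GF q) (@edge G') s.+2).
  by apply: IHd; rewrite /= nE addnS.
have Gstar1 : Graphs_star (fun q => count_sym (GF q) (@edge G) s.+1).
  by apply: IHd; rewrite nE addnS addSn.
have Gstar2 : Graphs_star (fun q => count_sym (GF q) (@edge G) s.+2).
  by apply: IHd; rewrite nE addnS !addSn.
have ne : s.+1 != (nvert G).+1.
  by rewrite nE eqSS addnS -addSn neq_ltn -addSn leq_addr.
apply: R_span_ext (R_spanZ (in_R_invXnsubXm ne) (R_spanB (R_spanB G'star
  (R_spanZ (in_R_Xn s.+2) Gstar2))
  (R_spanZ (in_R_XnsubXm s.+1 s.+2) Gstar1))) => q /=.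
rewrite count_sym_add_isolatedSS card_GF.
have nz := XnsubXm_neq0 q ne.
by field.
Qed.

(** Induction on [r - j]: for [j < r] the recursion is solved for [count_gram] at [j], since its
    coefficient [q ^ r - q ^ j] is a unit of [R]. *)
Lemma Graphs_star_count_gram (G : simple_graph) r j : (j <= r)%N ->
  Graphs_star (fun q => count_gram (GF q) (@edge G) r j).
Proof.
have [d] : exists d, (r = j + d)%N \/ (r < j)%N.
  by exists (r - j)%N; case: (leqP j r) => [/subnKC|]; [left|right].
case=> [rE _|ltrj lejr]; last by rewrite leqNgt ltrj in lejr.
elim: d => [|d IHd] in G j rE *.
  have glR : in_R (fun q => count_gl (GF q) r).
    apply: in_R_ext (in_R_prod (index_enum 'I_r) (P := xpredT)
      (c := fun i q => q%:R ^+ r - q%:R ^+ i) _) => [q|i _].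
      by rewrite /count_gl card_GF.
    exact: in_R_XnsubXm.
  have /= := R_spanZ glR (Graphs_star_count_sym G r).
  by apply: R_span_ext => q; rewrite -count_gram_full rE addn0.
pose G' := graph_add_isolated G.
have ne : j != r by rewrite rE neq_ltn addnS ltnS leq_addr.
have {}rE : r = (j.+1 + d)%N by rewrite rE addnS.
apply: R_span_ext (R_spanZ (in_R_invXnsubXm ne) (R_spanB (IHd G' _ rE)
  (R_spanZ (in_R_Xn j.+1) (IHd G _ rE)))) => q /=.
rewrite count_gram_add_isolated card_GF.
have nz := XnsubXm_neq0 q ne.
by field.
Qed.

(** * The number of invertible symmetric matrices *)

Section CountNondegenerate.
Variable F : finFieldType.
Local Notation q := (#|F|%:R : rat).

Definition count_nondeg (r : nat) : rat :=
  \sum_(Q : 'M[F]_r | nondeg_sym Q) 1.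

(** Without edges the preceding counts run over all symmetric matrices, and their recursions
    determine [count_nondeg]. *)
Definition edgeless n : rel 'I_n := fun _ _ => false.

Lemma has_zeros_edgeless n (A : 'M[F]_n) : has_zeros (@edgeless n) A.
Proof. exact/'forall_forallP. Qed.

Lemma has_zeros_add_edgeless n (A : 'M[F]_(1 + n)) :
  has_zeros (add_isolated (@edgeless n)) A.
Proof. by rewrite has_zeros_add_isolated has_zeros_edgeless. Qed.

Lemma count_sym_add_edgeless n :
  count_sym F (add_isolated (@edgeless n)) n.+1 = count_nondeg n.+1.
Proof.
apply: eq_bigl => Q.
by rewrite has_zeros_add_edgeless /nondeg_sym -row_free_unit andbT.
Qed.

Lemma count_sym_edgeless n : count_sym F (@edgeless n) n = count_nondeg n.
Proof.
apply: eq_bigl => Q.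
by rewrite has_zeros_edgeless /nondeg_sym -row_free_unit andbT.
Qed.

Lemma count_gl_neq0 r : count_gl F r != 0.
Proof.
apply/prodf_neq0 => i _; rewrite -!natrX subr_eq0 eqr_nat.
by rewrite eqn_exp2l ?finRing_gt1 // neq_ltn ltn_ord orbT.
Qed.

(** The factor of index 0 is split off, and each of the [r] others yields a factor [q]. *)
Lemma count_glS r : count_gl F r.+1 = (q ^+ r.+1 - 1) * q ^+ r * count_gl F r.
Proof.
rewrite /count_gl big_ord_recl /= expr0 -mulrA; congr (_ * _).
have qrE : q ^+ r = \prod_(i < r) q by rewrite prodr_const card_ord.
rewrite [X in _ = X * _]qrE -big_split /=.
by apply: eq_bigr => i _; rewrite !exprS mulrBr.
Qed.

(** Multiplied by [count_gl F n], the count becomes one of pairs [(Q, A)] with [A] of full column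
    rank; the extra factor [q ^+ n.+1 - q ^+ n] completes the number of such [A] to
    [count_gl F n.+1]. *)
Lemma count_sym_edgeless_corank1 n :
  (q ^+ n.+1 - q ^+ n) * count_sym F (@edgeless n.+1) n =
  (q ^+ n.+1 - 1) * q ^+ n * count_nondeg n.
Proof.
apply: (mulfI (count_gl_neq0 n)); rewrite mulrCA -count_gram_full /count_gram.
have -> : \sum_(Q : 'M[F]_n | nondeg_sym Q) \sum_(A : 'M[F]_(n.+1, n) |
    has_zeros (@edgeless n.+1) (A *m Q *m A^T) && (\rank A == n)) 1 =
    count_nondeg n * \prod_(i < n) (q ^+ n.+1 - q ^+ i) :> rat.
  rewrite mulr_suml; apply: eq_bigr => Q _; rewrite mul1r -sum_row_free.
  (* Transposition turns full column rank into the full row rank of [sum_row_free]. *)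
  rewrite (reindex (fun A : 'M[F]_(n, n.+1) => A^T)) /=; last first.
    by exists (fun A : 'M[F]_(n.+1, n) => A^T) => A _; apply: trmxK.
  apply: eq_bigl => A.
  by rewrite has_zeros_edgeless mxrank_tr.
have := count_glS n; rewrite {1}/count_gl big_ord_recr /= => E.
by rewrite mulrCA [X in _ * X]mulrC E; ring.
Qed.

(** An invertible matrix of size [n.+2] borders one of size [n.+1] and corank 0 or 1. *)
Lemma count_nondeg_rec n : count_nondeg n.+2 =
  q ^+ n.+1 * ((q - 1) * count_nondeg n.+1 + (q ^+ n.+1 - 1) * count_nondeg n).
Proof.
rewrite -count_sym_add_edgeless count_sym_add_isolatedSS.
rewrite count_sym_big // mulr0 add0r count_sym_edgeless.
have -> : q ^+ n.+2 - q ^+ n.+1 = q * (q ^+ n.+1 - q ^+ n).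
  by rewrite mulrBr -!exprS.
by rewrite -!mulrA count_sym_edgeless_corank1 !exprS; ring.
Qed.

Lemma count_nondeg0 : count_nondeg 0 = 1.
Proof.
rewrite /count_nondeg (eq_bigl xpredT) => [|Q].
  by rewrite sumr_const card_mx mul0n.
have -> : Q = 0 by apply: flatmx0.
by rewrite /nondeg_sym -row_free_unit /row_free mxrank0 trmx0 !eqxx.
Qed.

Lemma count_nondeg1 : count_nondeg 1 = q - 1.
Proof.
rewrite -count_sym_add_edgeless count_sym_add_isolated.
rewrite (eq_bigl xpredT) => [|S]; last first.
  have -> : S = 0 by apply: flatmx0.
  by rewrite has_zeros_edgeless trmx0 eqxx.
rewrite (eq_bigr (fun=> q - 1)) => [|S _]; last first.
  have -> : S = 0 by apply: flatmx0.
  by rewrite mxrank0 /= expr0; ring.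
by rewrite sumr_const card_mx mul0n.
Qed.

(** The second-order recursion collapses by parity, giving a product of factors [q ^ i] for even [i]
    and [q ^ i - 1] for odd [i], all units of [R]. *)
Lemma count_nondegS n :
  count_nondeg n.+1 = (q ^+ n.+1 - (odd n.+1)%:R) * count_nondeg n.
Proof.
elim: n => [|n IHn]; first by rewrite count_nondeg0 count_nondeg1 mulr1.
rewrite count_nondeg_rec [odd n.+2]/= negbK; move: IHn => /=.
by case: (odd n) => /= E; rewrite E !exprS; ring.
Qed.

Lemma count_nondegE r :
  count_nondeg r = \prod_(i < r) (q ^+ i.+1 - (odd i.+1)%:R).
Proof.
elim: r => [|r IHr]; first by rewrite big_ord0 count_nondeg0.
by rewrite count_nondegS big_ord_recr IHr mulrC.
Qed.

Lemma count_nondeg_neq0 r : count_nondeg r != 0.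
Proof.
rewrite count_nondegE; apply/prodf_neq0 => i _.
rewrite -natrX subr_eq0 eqr_nat neq_ltn.
rewrite (leq_ltn_trans (leq_b1 _)) ?orbT //.
by rewrite -(exp1n i.+1) ltn_exp2r ?finRing_gt1.
Qed.

End CountNondegenerate.

Lemma in_R_inv_count_nondeg r : in_R (fun q => (count_nondeg (GF q) r)^-1).
Proof.
apply: in_R_ext (in_R_prod (index_enum 'I_r) (P := xpredT)
  (c := fun i q => (q%:R ^+ i.+1 - (odd i.+1)%:R)^-1) _) => [q|i _].
  by rewrite count_nondegE prodfV card_GF.
case: (odd i.+1); last by apply: in_R_ext (in_R_invXn i.+1) => q; rewrite subr0.
by apply: in_R_ext (@in_R_invXnsubXm 0 i.+1 isT).
Qed.

(** * Configurations of vectors *)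

Section Orthogonality.
Variables (F : finFieldType) (E : finType) (r : nat).
Local Notation q := (#|F|%:R : rat).
Implicit Types (f : {ffun E -> 'rV[F]_r}) (X : {set E}).

(** The truncated subtraction is exact by [dim_rV_le]. *)
Definition corank f X : nat := (r - \dim <<[seq f x | x in X]>>)%N.

Lemma dim_rV_le (U : {vspace 'rV[F]_r}) : (\dim U <= r)%N.
Proof.
by apply: leq_trans (dimvS (subvf U)) _; rewrite dimvf /dim /= mul1n.
Qed.

(** With a basis of the span of [f(X)] as the rows of [B], the [h] form the kernel of [(B *m Q)^T],
    and [B *m Q] has the rank of [B]. *)
Lemma sum_orthogonal f X (Q : 'M[F]_r) : Q \in unitmx ->
  \sum_(h : 'rV[F]_r | [forall x in X, f x *m Q *m h^T == 0]) 1 =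
  q ^+ corank f X.
Proof.
move=> Qunit; rewrite /corank; set U := <<_>>%VS.
pose B : 'M[F]_(\dim U, r) := \matrix_i (vbasis U)`_i.
have rkB : \rank B = \dim U.
  apply/eqP; rewrite -[_ == _]/(row_free B) -kermx_eq0; apply/rowV0P => u.
  move/sub_kermxP; rewrite mulmx_sum_row => uB0.
  apply/rowP => i; rewrite [RHS]mxE.
  have /freeP := basis_free (vbasisP U); apply => //.
  by rewrite -[RHS]uB0; apply: eq_bigr => j _; rewrite rowK.
have rkBQ : \rank (kermx (B *m Q)^T) = (r - \dim U)%N.
  by rewrite mxrank_ker mxrank_tr mxrankMfree ?row_free_unit // rkB.
rewrite -rkBQ -sum_submx; apply: eq_bigl => h.
rewrite sub_kermx -(inj_eq (@trmx_inj _ _ _)) trmx_mul trmxK trmx0.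
pose g := linfun (mulmxr (Q *m h^T) : 'rV[F]_r -> 'M[F]_1).
have gE v : g v = v *m Q *m h^T by rewrite lfunE /= mulmxA.
(* Orthogonality to [h] is membership in the subspace [lker g], so it may be tested on any spanning
   family of [U]. *)
have -> : [forall x in X, f x *m Q *m h^T == 0] = (U <= lker g)%VS.
  apply/forall_inP/span_subvP => [fX _ /imageP[x xX ->]|fX x xX].
    by rewrite memv_ker gE fX.
  by rewrite -gE -memv_ker; apply/fX/imageP; exists x.
have <- : (<<vbasis U>> <= lker g)%VS = (U <= lker g)%VS.
  by rewrite (span_basis (vbasisP U)).
apply/span_subvP/eqP => [bU|BQh _ /tnthP[i ->]].
  apply/row_matrixP => i; rewrite !row_mul rowK row0 -gE.
  by apply/eqP; rewrite -memv_ker bU // mem_nth ?size_tuple.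
rewrite memv_ker gE (tnth_nth 0); move/(congr1 (row i)): BQh.
by rewrite !row_mul rowK row0 => /eqP.
Qed.

End Orthogonality.

(** * Incidence graphs of lists of subsets *)

Section IncidenceGraph.
Variables (E : finType) (L : seq {set E}).

(** A list allows a subset to occur several times, which produces powers of its factor
    [q ^+ corank f X]. *)
Definition incident : rel 'I_(#|E| + size L) := fun i j =>
  match split i, split j with
  | inl a, inr b | inr b, inl a => enum_val a \in nth set0 L b
  | _, _ => false
  end.

Lemma incident_sym : symmetric incident.
Proof. by move=> i j; rewrite /incident; case: (split i); case: (split j). Qed.

Lemma incident_irrefl : irreflexive incident.
Proof. by move=> i; rewrite /incident; case: (split i). Qed.

Definition incidence_graph := SimpleGraph incident_sym incident_irrefl.

Variables (F : finFieldType) (r : nat).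
Local Notation q := (#|F|%:R : rat).

(** Only Gram entries between an [f x] and an [h b] are constrained; the symmetry of [Q] identifies
    the two off-diagonal blocks. *)
Lemma has_zeros_incident (Q : 'M[F]_r) (f : {ffun E -> 'rV[F]_r})
    (h : {ffun 'I_(size L) -> 'rV[F]_r}) (A : 'M[F]_(#|E| + size L, r)) :
    Q^T = Q ->
    A = col_mx (\matrix_(a < #|E|) f (enum_val a)) (\matrix_b h b) ->
  has_zeros incident (A *m Q *m A^T) =
  (h \in family (fun b : 'I_(size L) =>
     [pred v : 'rV[F]_r | [forall x in nth set0 L b, f x *m Q *m v^T == 0]])).
Proof.
move=> Qsym AE.
have gramE i j : (A *m Q *m A^T) i j = (row i A *m Q *m (row j A)^T) ord0 ord0.
  by rewrite -row_mul !mxE; apply: eq_bigr => k _; rewrite !mxE.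
have gramC i j : (A *m Q *m A^T) i j = (A *m Q *m A^T) j i.
  by rewrite -[in LHS](trmxK (A *m Q *m A^T)) mxE !trmx_mul trmxK Qsym mulmxA.
have gram_lr a b : ((A *m Q *m A^T) (lshift _ a) (rshift _ b) == 0) =
    (f (enum_val a) *m Q *m (h b)^T == 0).
  rewrite gramE AE rowKu rowKd !rowK [in RHS](mx11_scalar (_ *m _)).
  by rewrite -scalemx1 scalemx_eq0 oner_eq0 orbF.
apply/'forall_forallP/familyP => [eA b|fh i j]; last first.
  apply/implyP; rewrite /incident.
  case: (split_ordP i) => a ->; case: (split_ordP j) => b -> // ab; last first.
    rewrite gramC gram_lr.
    by have := fh a; rewrite inE => /forall_inP; apply.
  rewrite gram_lr.
  by have := fh b; rewrite inE => /forall_inP; apply.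
rewrite inE; apply/forall_inP => x xb.
have := eA (lshift _ (enum_rank x)) (rshift _ b).
rewrite /incident (unsplitK (inl _)) (unsplitK (inr _)) enum_rankK xb /=.
by rewrite gram_lr enum_rankK.
Qed.

(** The sum over [j] removes the rank condition, and [A] splits into [f] and [h]. Once [Q] and [f]
    are fixed, the vectors [h b] are chosen independently, each in an orthogonal complement. *)
Lemma sum_count_gram_incident :
  \sum_(j < r.+1) count_gram F incident r j =
  count_nondeg F r *
    \sum_(f : {ffun E -> 'rV[F]_r}) \prod_(X <- L) q ^+ corank f X.
Proof.
rewrite /count_gram exchange_big mulr_suml /=.
apply: eq_bigr => Q /andP[Qunit /eqP Qsym]; rewrite mul1r.
transitivity (\sum_(A : 'M[F]_(#|E| + size L, r)
    | has_zeros incident (A *m Q *m A^T)) (1 : rat)).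
  rewrite (partition_big (fun A => inord (\rank A) : 'I_r.+1) xpredT) //=.
  apply: eq_bigr => j _; apply: eq_bigl => A; congr (_ && _).
  by rewrite -val_eqE /= inordK // ltnS rank_leq_col.
pose glue (x : {ffun E -> 'rV[F]_r} * {ffun 'I_(size L) -> 'rV[F]_r}) :=
  col_mx (\matrix_(a < #|E|) x.1 (enum_val a)) (\matrix_b x.2 b).
pose unglue (A : 'M[F]_(#|E| + size L, r)) :=
  ([ffun x => row (lshift _ (enum_rank x)) A] : {ffun E -> 'rV[F]_r},
   [ffun b => row (rshift _ b) A] : {ffun 'I_(size L) -> 'rV[F]_r}).
rewrite (reindex_onto glue unglue) => [|A _]; last first.
  rewrite /glue /unglue /= -[RHS]vsubmxK; congr col_mx.
    by apply/row_matrixP => a; rewrite rowK ffunE enum_valK row_usubmx.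
  by apply/row_matrixP => b; rewrite rowK ffunE row_dsubmx.
pose P (f : {ffun E -> 'rV[F]_r}) (b : 'I_(size L)) :=
  [pred v : 'rV[F]_r | [forall x in nth set0 L b, f x *m Q *m v^T == 0]].
rewrite (eq_bigl (fun x => x.2 \in family (P x.1))) => [|[f h]]; last first.
  rewrite (has_zeros_incident Qsym (erefl _)) /=; apply: andb_idr => _.
  apply/eqP; congr (_, _); apply/ffunP => x; rewrite ffunE.
    by rewrite rowKu rowK enum_rankK.
  by rewrite rowKd rowK.
rewrite -(pair_big_dep xpredT (fun f h => h \in family (P f))
  (fun _ _ => 1)) /=.
apply: eq_bigr => f _.
transitivity (\prod_(b < size L) \sum_(v | P f b v) (1 : rat)).
  by rewrite bigA_distr_big_dep; apply: eq_bigr => h _; rewrite big1_eq.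
rewrite (big_nth set0) big_mkord; apply: eq_bigr => b _.
exact: sum_orthogonal.
Qed.

End IncidenceGraph.

(** * Interpolation of the rank conditions *)

Lemma Graphs_star_configurations (E : finType) (r : nat) (L : seq {set E}) :
  Graphs_star (fun q => \sum_(f : {ffun E -> 'rV[GF q]_r})
    \prod_(X <- L) q%:R ^+ corank f X).
Proof.
have /= := R_spanZ (in_R_inv_count_nondeg r) (R_span_sum (index_enum 'I_r.+1)
  (fun j => Graphs_star_count_gram (incidence_graph L) (leq_ord j))).
apply: R_span_ext => q.
rewrite [X in _ * X](sum_count_gram_incident L (GF q) r).
by rewrite mulKf ?count_nondeg_neq0 // card_GF.
Qed.

(** The product over [K] is expanded one factor at a time: its first term adds [X] to [L], its
    second is a scalar of [R]. *)
Lemma Graphs_star_weighted_configurations (E : finType) (r : nat)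
    (L : seq {set E}) (K : seq ({set E} * 'I_r.+1)) :
  Graphs_star (fun q => \sum_(f : {ffun E -> 'rV[GF q]_r})
    (\prod_(X <- L) q%:R ^+ corank f X)
      * \prod_(p <- K) (q%:R ^+ corank f p.1 - q%:R ^+ p.2)).
Proof.
elim: K L => [|[X s] K IHK] L.
  apply: R_span_ext (Graphs_star_configurations r L) => q.
  by apply: eq_bigr => f _; rewrite big_nil mulr1.
apply: R_span_ext (R_spanB (IHK (X :: L)) (R_spanZ (in_R_Xn s) (IHK L))) => q.
rewrite mulr_sumr -sumrB; apply: eq_bigr => f _ /=; rewrite !big_cons /=.
set w := \prod_(_ <- L) _.
by rewrite mulrBl mulrBr !mulrA ![w * _]mulrC.
Qed.

(** This is the Lagrange basis polynomial of the node [q ^ s0] evaluated at [q ^ p]; if [p] differs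
    from [s0], the factor [s = p] vanishes. *)
Lemma lagrange_indicator (q : prime_power) (r p s0 : nat) : (p <= r)%N ->
  \prod_(s < r.+1 | s != s0 :> nat)
     ((q%:R ^+ p - q%:R ^+ s) / (q%:R ^+ s0 - q%:R ^+ s)) =
  (p == s0)%:R :> rat.
Proof.
move=> lepr; case: eqP => [->|/eqP ne].
  by rewrite big1 // => s ne; rewrite divff // XnsubXm_neq0.
by rewrite (bigD1 (Ordinal (lepr : (p < r.+1)%N))) //= subrr mul0r mul0r.
Qed.

Lemma Graphs_star_X_fun (M : matroid) : Graphs_star (X_fun M).
Proof.
set r := matroid_rank M.
pose s0 (X : {set ground M}) := (r - mrank X)%N.
pose P (p : {set ground M} * 'I_r.+1) := p.2 != s0 p.1 :> nat.
(* All numerators of the Lagrange indicators, over every subset at once; the denominators do not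
   depend on [f] and form the scalar in [cR]. *)
pose K := [seq p <- index_enum ({set ground M} * 'I_r.+1)%type | P p].
have cR : in_R (fun q => \prod_(p <- K) (q%:R ^+ s0 p.1 - q%:R ^+ p.2)^-1).
  apply: in_R_ext (in_R_prod (index_enum ({set ground M} * 'I_r.+1)%type)
    (P := P) (c := fun p q => (q%:R ^+ s0 p.1 - q%:R ^+ p.2)^-1) _) => [q|p Pp].
    by rewrite big_filter.
  exact: in_R_invXnsubXm.
have /= := R_spanZ cR (Graphs_star_weighted_configurations [::] K).
apply: R_span_ext => q.
rewrite /X_fun /point_count -sum1_card natr_sum mulr_sumr [LHS]big_mkcond.
apply: eq_bigr => f _; rewrite big_nil mul1r mulrC -big_split /= big_filter.
rewrite -(pair_big_dep xpredT (fun X (s : 'I_r.+1) => s != s0 X :> nat)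
  (fun X s => (q%:R ^+ corank f X - q%:R ^+ s)
                / (q%:R ^+ s0 X - q%:R ^+ s))) /=.
under eq_bigr do rewrite lagrange_indicator ?leq_subr //.
(* Both subtractions from [r] are exact, so equal coranks mean equal ranks. *)
have rankE X : (corank f X == s0 X) = (\dim <<[seq f x | x in X]>> == mrank X).
  have le1 := dim_rV_le <<[seq f x | x in X]>>%VS.
  have le2 : (mrank X <= r)%N by apply/mrank_mono/subsetT.
  by rewrite /corank /s0 eqn_sub2lE.
rewrite inE; case: ifP => [/forallP fM|/negbT/forallPn[X fX]].
  by rewrite big1 // => X _; rewrite rankE fM.
by rewrite (bigD1 X) //= rankE (negbTE fX) mul0r.
Qed.

Theorem theorem10p3 (f : prime_power -> rat) : Matroids f -> Graphs_star f.
Proof.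
by apply: R_span_trans => _ [M ->]; apply: Graphs_star_X_fun.
Qed.
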